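(* Let $\Gamma$ be a finitely generated non-amenable group acting freely in a measure-preserving manner on a standard probability space $(X,\mu)$. Then neither $[\Gamma]_1$ nor the closure $\overline{D([\Gamma]_1)}$ of its derived group in $[\Gamma]_1$ is amenable (as a topological group).
   Context: A standard probability space $(X,\mu)$ is a standard Borel space with a non-atomic Borel probability measure. $\mathrm{Aut}(X,\mu)$ is the group of measure-preserving Borel bijections of $X$, identified when they agree almost everywhere. For a measure-preserving action of $\Gamma$ on $(X,\mu)$, $[\Gamma]=\{T\in\mathrm{Aut}(X,\mu): T(x)\in\Gamma\cdot x\text{ for a.e. }x\in X\}$. Let $S$ be a finite generating set of $\Gamma$; each $\Gamma$-orbit carries the Schreier graph metric $d_S$, where $d_S(x,y)$ is the least $n$ such that $y=s_n\cdots s_1x$ with $s_i\in S\cup S^{-1}$. The $\mathrm L^1$ full group is $[\Gamma]_1=\{T\in[\Gamma]:\int_Xd_S(x,T(x))\,d\mu(x)<+\infty\}$, with the topology induced by the metric $\tilde d_S(T,U)=\int_Xd_S(T(x),U(x))\,d\mu(x)$; neither the group nor its topology depends on $S$. $D(G)$ denotes the derived subgroup of $G$. The discrete group $\Gamma$ is non-amenable in the usual sense; a topological group is amenable if every continuous action of it on a (nonempty) compact Hausdorff space admits an invariant Borel probability measure. *)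

(* Defs.v *)
From HB Require Import structures.
From mathcomp Require Import all_boot all_order all_algebra generic_quotient.
From mathcomp Require Import all_classical all_reals all_analysis measurable_realfun.
From mathcomp Require Import lra.

Set Implicit Arguments.
Unset Strict Implicit.
Unset Printing Implicit Defensive.

Import Order.TTheory GRing.Theory Num.Theory.

Local Open Scope classical_set_scope.
Local Open Scope ring_scope.

(* Up to a bijection [f], the measurable sets are the Borel sets of a Polish
   space; Polish is rendered as second countable, Hausdorff and complete for a
   pseudometric (hence for a metric). *)
HB.mixin Record isStandardBorel (R : realType) d X & Measurable d X := {
  standard_borel_subproof : exists (P : completePseudoMetricType R) (f : X -> P),
    [/\ hausdorff_space P, @second_countable P, bijective f &
        @measurable d X = preimage_set_system setT f <<s @open P >>]
}.

#[short(type="standardBorelType")]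
HB.structure Definition StandardBorel (R : realType) d :=
  {X of Measurable d X & isStandardBorel R d X}.

Definition nonatomic (R : realType) d (X : measurableType d)
    (mu : probability X R) : Prop :=
  forall A, measurable A -> (0 < mu A)%E ->
  exists B, [/\ measurable B, B `<=` A, (0 < mu B)%E & (mu B < mu A)%E].

Section generated_subgroup.
Context (G : groupType).
Local Open Scope group_scope.

Definition subgroup (H : set G) : Prop :=
  H 1 /\ forall g h, H g -> H h -> H (g * h^-1).

Definition subgroup_generated (A : set G) : set G := smallest subgroup A.

Definition derived_subgroup : set G :=
  subgroup_generated [set [~ g, h] | g in [set: G] & h in [set: G]].

End generated_subgroup.
Arguments derived_subgroup : clear implicits.

(* A left-invariant finitely additive probability on all subsets of [G]. *)
Definition amenable_discrete (R : realType) (G : groupType) : Prop :=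
  exists m : set G -> R,
  [/\ forall A, 0 <= m A,
      m setT = 1,
      forall A B, A `&` B = set0 -> m (A `|` B) = m A + m B &
      forall g A, m ([set (g * h)%g | h in A]) = m A].

HB.mixin Record isTopologicalGroup G & Group G & Topological G := {
  mulg_continuous : continuous (fun p : G * G => (p.1 * p.2)%g);
  invg_continuous : continuous (fun g : G => (g^-1)%g)
}.

#[short(type="topologicalGroupType")]
HB.structure Definition TopologicalGroup :=
  {G of Group G & Topological G & isTopologicalGroup G}.

(* Subgroups of a topological group are represented by sets and carry the
   subspace topology. An action of [H] is given by a total function on [G] whose
   values outside [H] are irrelevant. *)
Section amenable_subgroup.
Context (G : topologicalGroupType).

Definition continuous_action (H : set G) (K : topologicalType)
    (act : G -> K -> K) : Prop :=
  [/\ forall x, act 1%g x = x,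
      forall g h x, H g -> H h -> act (g * h)%g x = act g (act h x) &
      {within H `*` [set: K], continuous (fun p : G * K => act p.1 p.2)}].

(* Non-emptiness of [K] is the point of the [ptopologicalType]; [<<s @open K >>]
   is the Borel sigma-algebra of [K]. *)
Definition amenable (R : realType) (H : set G) : Prop :=
  forall (K : ptopologicalType) (act : G -> K -> K),
  compact [set: K] -> hausdorff_space K -> continuous_action H act ->
  exists m : probability (g_sigma_algebraType (@open K)) R,
    forall g A, H g -> <<s @open K >> A -> m (act g @^-1` A) = m A.

End amenable_subgroup.

Section automorphisms.
Context (R : realType) d (X : measurableType d) (mu : probability X R).

(* On a standard Borel space the inverse of a Borel bijection is automatically
   Borel, so [mp_inv_measurable] is no restriction there. *)
Record mp_bijection := MPBijection {
  mp_fun :> X -> X;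
  mp_inv : X -> X;
  mp_funK : cancel mp_fun mp_inv;
  mp_invK : cancel mp_inv mp_fun;
  mp_measurable : measurable_fun setT mp_fun;
  mp_inv_measurable : measurable_fun setT mp_inv;
  mp_preserving : forall A, measurable A -> mu (mp_fun @^-1` A) = mu A
}.

HB.instance Definition _ := gen_eqMixin mp_bijection.
HB.instance Definition _ := gen_choiceMixin mp_bijection.

Lemma mp_preimageE (f : mp_bijection) A :
  measurable A -> measurable (f @^-1` A).
Proof. by move=> mA; rewrite -[_ @^-1` _]setTI; exact: mp_measurable. Qed.

Program Definition mp_id := @MPBijection idfun idfun _ _ _ _ _.
Next Obligation. by []. Qed.
Next Obligation. by []. Qed.
Next Obligation. exact: measurable_id. Qed.
Next Obligation. exact: measurable_id. Qed.
Next Obligation. by []. Qed.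

Program Definition mp_comp (f g : mp_bijection) :=
  @MPBijection (f \o g) (mp_inv g \o mp_inv f) _ _ _ _ _.
Next Obligation. by move=> f g; apply: can_comp; exact: mp_funK. Qed.
Next Obligation. by move=> f g; apply: can_comp; exact: mp_invK. Qed.
Next Obligation.
by move=> f g; apply: measurableT_comp; exact: mp_measurable.
Qed.
Next Obligation.
by move=> f g; apply: measurableT_comp; exact: mp_inv_measurable.
Qed.
Next Obligation.
move=> f g A mA; rewrite comp_preimage !mp_preserving//.
exact: mp_preimageE.
Qed.

Program Definition mp_inverse (f : mp_bijection) :=
  @MPBijection (mp_inv f) f _ _ _ _ _.
Next Obligation. exact: mp_invK. Qed.
Next Obligation. exact: mp_funK. Qed.
Next Obligation. exact: mp_inv_measurable. Qed.
Next Obligation. exact: mp_measurable. Qed.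
Next Obligation.
move=> f A mA; rewrite -[LHS](mp_preserving f); last first.
  by rewrite -[_ @^-1` _]setTI; exact: mp_inv_measurable.
by congr (mu _); apply/seteqP; split=> x; rewrite /preimage/= mp_funK.
Qed.

Lemma mp_ae (f : mp_bijection) (P : X -> Prop) :
  (\forall x \ae mu, P x) -> \forall x \ae mu, P (f x).
Proof.
move=> [N [mN N0 PN]]; exists (f @^-1` N); split.
- exact: mp_preimageE.
- by rewrite mp_preserving.
- by move=> x /= nP; exact: PN.
Qed.

Definition mp_eq (f g : mp_bijection) : bool :=
  `[< \forall x \ae mu, f x = g x >].

Lemma mp_eqP (f g : mp_bijection) :
  reflect (\forall x \ae mu, f x = g x) (mp_eq f g).
Proof. exact: asboolP. Qed.

Lemma mp_eq_refl : reflexive mp_eq.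
Proof. by move=> f; apply/mp_eqP; exact: aeW. Qed.

Lemma mp_eq_sym : symmetric mp_eq.
Proof. by move=> f g; apply/mp_eqP/mp_eqP; apply: filterS => x ->. Qed.

Lemma mp_eq_trans : transitive mp_eq.
Proof.
move=> g f h /mp_eqP fg /mp_eqP gh; apply/mp_eqP.
by apply: filterS2 fg gh => x -> ->.
Qed.

Canonical mp_eq_equiv := EquivRel mp_eq mp_eq_refl mp_eq_sym mp_eq_trans.

Definition Aut := {eq_quot mp_eq}%qT.

HB.instance Definition _ := Choice.on Aut.
HB.instance Definition _ := EqQuotient.on Aut.

(* Every notion below that goes through the representative [repr T] depends on
   it only up to null sets. *)
Definition aut_fun (T : Aut) : X -> X := (repr T : mp_bijection).

Lemma aut_eqP (T U : Aut) :
  (\forall x \ae mu, aut_fun T x = aut_fun U x) <-> T = U.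
Proof.
split=> [TU|-> //]; last exact: aeW.
by rewrite -[T]reprK -[U]reprK; apply/eqmodP/mp_eqP.
Qed.

Lemma aut_fun_pi (f : mp_bijection) :
  \forall x \ae mu, aut_fun (\pi_Aut f)%qT x = f x.
Proof. by apply/mp_eqP/eqmodP; rewrite reprK. Qed.

Definition aut_one : Aut := (\pi_Aut mp_id)%qT.
Definition aut_mul (T U : Aut) : Aut := (\pi_Aut (mp_comp (repr T) (repr U)))%qT.
Definition aut_inv (T : Aut) : Aut := (\pi_Aut (mp_inverse (repr T)))%qT.

Lemma aut_oneE : \forall x \ae mu, aut_fun aut_one x = x.
Proof. exact: aut_fun_pi. Qed.

Lemma aut_mulE (T U : Aut) :
  \forall x \ae mu, aut_fun (aut_mul T U) x = aut_fun T (aut_fun U x).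
Proof. exact: aut_fun_pi. Qed.

Lemma aut_invE (T : Aut) :
  \forall x \ae mu, aut_fun (aut_inv T) x = mp_inv (repr T) x.
Proof. exact: aut_fun_pi. Qed.

Lemma aut_mulA : associative aut_mul.
Proof.
move=> T U V; apply/aut_eqP.
have e : \forall x \ae mu,
    aut_fun (aut_mul (aut_mul T U) V) x = aut_fun T (aut_fun U (aut_fun V x)).
  apply: filterS2 (aut_mulE (aut_mul T U) V) (mp_ae (repr V) (aut_mulE T U)).
  by move=> x -> <-.
apply: filterS3 e (aut_mulE T (aut_mul U V)) (aut_mulE U V).
by move=> x -> -> ->.
Qed.

Lemma aut_mul1 : left_id aut_one aut_mul.
Proof.
move=> T; apply/aut_eqP; have := mp_ae (repr T) aut_oneE.
by apply: filterS2 (aut_mulE aut_one T) => x -> ->.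
Qed.

Lemma aut_1mul : right_id aut_one aut_mul.
Proof.
move=> T; apply/aut_eqP.
by apply: filterS2 (aut_mulE T aut_one) aut_oneE => x -> ->.
Qed.

Lemma aut_mulV : left_inverse aut_one aut_inv aut_mul.
Proof.
move=> T; apply/aut_eqP; have := mp_ae (repr T) (aut_invE T).
apply: filterS3 (aut_mulE (aut_inv T) T) aut_oneE => x -> -> e.
by rewrite e mp_funK.
Qed.

Lemma aut_Vmul : right_inverse aut_one aut_inv aut_mul.
Proof.
move=> T; apply/aut_eqP.
apply: filterS3 (aut_mulE T (aut_inv T)) aut_oneE (aut_invE T) => x -> -> ->.
by rewrite /aut_fun mp_invK.
Qed.

HB.instance Definition _ :=
  isGroup.Build Aut aut_mulA aut_mul1 aut_1mul aut_mulV aut_Vmul.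

End automorphisms.

Section actions.
Context (R : realType) d (X : measurableType d) (mu : probability X R).
Context (Gamma : groupType).

Record pmp_action := PmpAction {
  pmp_fun :> Gamma -> X -> X;
  pmp_act1 : forall x, pmp_fun 1%g x = x;
  pmp_actM : forall g h x, pmp_fun (g * h)%g x = pmp_fun g (pmp_fun h x);
  pmp_measurable : forall g, measurable_fun setT (pmp_fun g);
  pmp_preserving : forall g A, measurable A -> mu (pmp_fun g @^-1` A) = mu A
}.

(* Freeness up to a null set, which in particular covers everywhere free
   actions. *)
Definition free_action (a : pmp_action) : Prop :=
  \forall x \ae mu, forall g, a g x = x -> g = 1%g.

Definition full_group (a : pmp_action) : set (Aut mu) :=
  [set T | \forall x \ae mu, exists g, aut_fun T x = a g x].

Definition letter (S : seq Gamma) : pred Gamma :=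
  fun s => (s \in S) || (s^-1%g \in S).

(* For [w = [:: s_n; ..; s_1]], [foldr a x w] is [s_n ... s_1 x]. The infimum is
   a minimum when [y] is in the orbit of [x] under the group generated by [S],
   and [+oo] otherwise; see [dS_cases] below. *)
Definition schreier_dist (a : pmp_action) (S : seq Gamma) (x y : X) : \bar R :=
  ereal_inf [set (size w)%:R%:E | w in
               [set w : seq Gamma | all (letter S) w /\ y = foldr a x w]].

Definition l1_dist (a : pmp_action) (S : seq Gamma) (T U : Aut mu) : \bar R :=
  (\int[mu]_x schreier_dist a S (aut_fun T x) (aut_fun U x))%E.

Definition l1_full_set (a : pmp_action) (S : seq Gamma) : set (Aut mu) :=
  [set T | full_group a T /\
     (\int[mu]_x schreier_dist a S x (aut_fun T x) < +oo)%E].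

End actions.

Lemma measurable_eq_fun (R : realType) d (X : standardBorelType R d)
    (f g : X -> X) :
  measurable_fun setT f -> measurable_fun setT g ->
  measurable [set x | f x = g x].
Proof.
move=> mf mg.
have [P [h [hP [B cB [Bo Bb]] bh mE]]] := @standard_borel_subproof R d X.
have mh U : B U -> measurable (h @^-1` U).
  move=> BU; rewrite mE; exists U; last by rewrite setTI.
  by apply: sub_sigma_algebra; exact: Bo.
pose F U := f @^-1` (h @^-1` U) `&` ~` (g @^-1` (h @^-1` U)).
have mF U : B U -> measurable (F U).
  move=> BU; apply: measurableI; last apply: measurableC.
    by rewrite -[_ @^-1` _]setTI; apply: mf => //; exact: mh.
  by rewrite -[_ @^-1` _]setTI; apply: mg => //; exact: mh.
have -> : [set x | f x = g x] = ~` (\bigcup_(U in B) F U).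
  apply/seteqP; split=> [x fg [U BU]|x nF /=]; first by rewrite /F/= fg => -[].
  apply: contrapT => /eqP fgx; apply: nF.
  have hfg : h (f x) != h (g x) by apply: contra_neq fgx; exact: bij_inj.
  have [U [oU]] := hausdorff_accessible hP hfg; rewrite !inE => Uf Ug.
  have [V [BV Vf] VU] := Bb (h (f x)) U (open_nbhs_nbhs (conj oU Uf)).
  by exists V => //; split => //= Vg; exact/Ug/VU.
apply: measurableC; move/pfcard_geP : cB => [->|[e]].
  by rewrite bigcup_set0.
rewrite -[X in bigcup X _](image_eq e).
by rewrite bigcup_image; apply: bigcup_measurable => n _; apply: mF; exact: funS.
Qed.

Section schreier_dist_theory.
Context (R : realType) d (X : standardBorelType R d) (mu : probability X R).
Context (Gamma : groupType) (a : pmp_action mu Gamma) (S : seq Gamma).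

Local Notation dS := (schreier_dist a S).
Local Open Scope ereal_scope.

Lemma dS_le w x : all (letter S) w -> dS x (foldr a x w) <= (size w)%:R%:E.
Proof. by move=> Sw; apply: ereal_inf_lbound; exists w. Qed.

Lemma dS_ge0 x y : 0 <= dS x y.
Proof.
by apply: le_ereal_inf_tmp => _ [w _ <-]; rewrite lee_fin ler0n.
Qed.

Lemma dS_cases x y : dS x y = +oo \/ exists w,
  [/\ all (letter S) w, y = foldr a x w & dS x y = (size w)%:R%:E].
Proof.
pose Q n := `[< exists w, [/\ all (letter S) w, y = foldr a x w & size w = n] >].
have [[n Qn]|nQ] := pselect (exists n, Q n).
  right; have exQ : exists n, Q n by exists n.
  case: (ex_minnP exQ) => m /asboolP[w [Sw yw sw]] minm.
  exists w; split => //; apply/eqP; rewrite eq_le; apply/andP; split.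
    by rewrite yw; exact: dS_le.
  apply: le_ereal_inf_tmp => _ [w' [Sw' yw'] <-].
  by rewrite lee_fin ler_nat sw; apply: minm; apply/asboolP; exists w'.
left; rewrite /schreier_dist (_ : [set _ | _ in _] = set0) ?ereal_inf0//.
apply/seteqP; split=> // r [w [Sw yw] _]; apply: nQ; exists (size w).
by apply/asboolP; exists w.
Qed.

Lemma dSxx x : dS x x = 0.
Proof.
apply/eqP; rewrite eq_le dS_ge0 andbT.
exact: (@dS_le [::] x).
Qed.

Lemma dS_ge1 x y : x <> y -> 1 <= dS x y.
Proof.
move=> xy; have [->|[w [_ yw ->]]] := dS_cases x y; first exact: leey.
by case: w yw => [/esym//|g w _]; rewrite lee_fin ler1n.
Qed.

Lemma letterV s : letter S s -> letter S s^-1%g.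
Proof. by rewrite /letter invgK orbC. Qed.

Lemma foldr_rev_inv w x : foldr a (foldr a x w) (rev ([seq g^-1%g | g <- w])) = x.
Proof.
elim: w x => [//|g w IH] x /=; rewrite rev_cons -cats1 foldr_cat/=.
by rewrite -pmp_actM mulVg pmp_act1 IH.
Qed.

Lemma dS_sym x y : dS x y = dS y x.
Proof.
suff dS_le_sym u v : dS u v <= dS v u by apply/eqP; rewrite eq_le !dS_le_sym.
have [->|[w [Sw -> ->]]] := dS_cases v u; first by rewrite leey.
rewrite -{2}(foldr_rev_inv w v) -(size_map (fun g : Gamma => g^-1%g)) -size_rev; apply: dS_le.
rewrite all_rev all_map; apply: sub_all Sw => s; exact: letterV.
Qed.

Lemma dS_triangle y x z : dS x z <= dS x y + dS y z.
Proof.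
have [->|[w [Sw -> ->]]] := dS_cases x y.
  by rewrite addye ?leey// -ltNye (lt_le_trans _ (dS_ge0 _ _)).
have [->|[w' [Sw' -> ->]]] := dS_cases (foldr a x w) z; first by rewrite addey ?leey.
rewrite -foldr_cat -EFinD -natrD addnC -size_cat; apply: dS_le.
by rewrite all_cat Sw' Sw.
Qed.

Lemma measurable_dS (f g : X -> X) :
  measurable_fun setT f -> measurable_fun setT g ->
  measurable_fun setT (fun x => dS (f x) (g x)).
Proof.
move=> mf mg _; apply: (measurability _ (ErealGenInftyO.measurableE R)) => //.
move=> _ [_ [r ->] <-]; rewrite setTI.
pose L := S ++ [seq s^-1%g | s <- S].
pose word (s : seq nat) := [seq nth 1%g L i | i <- s].
have wordP w : all (letter S) w -> exists s, w = word s.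
  move=> Sw; exists [seq index s L | s <- w]; rewrite /word -map_comp.
  rewrite -[LHS]map_id; apply/eq_in_map => s ws /=; rewrite nth_index//.
  have := allP Sw _ ws; rewrite /letter mem_cat => /orP[->//|sS].
  by apply/orP; right; apply/mapP; exists s^-1%g => //; rewrite invgK.
pose F s := if all (letter S) (word s) && ((size (word s))%:R < r)%R
  then [set x | g x = foldr a (f x) (word s)] else set0.
rewrite (_ : _ @^-1` _ = \bigcup_s F s); last first.
  apply/seteqP; split=> x /=.
    rewrite in_itv/= => /ereal_inf_lt[_ [w [Sw gw] <-]] wr.
    have [s ws] := wordP _ Sw; exists s => //.
    by rewrite /F -ws Sw -lte_fin wr.
  rewrite /F => -[s _]; case: ifPn => // /andP[Sw wr] /= ->.
  by rewrite in_itv/=; apply: le_lt_trans (dS_le _ Sw) _; rewrite lte_fin.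
apply: countable_bigcupT_measurable => [//|s].
rewrite /F; case: ifPn => // _; apply: measurable_eq_fun => //.
elim: (word s) => [//|t w IH] /=.
by apply: measurableT_comp IH; exact: pmp_measurable.
Qed.

Lemma measurable_aut (T : Aut mu) : measurable_fun setT (aut_fun T).
Proof. exact: mp_measurable. Qed.
Hint Resolve measurable_aut : core.

Lemma integral_aut (T : Aut mu) (F : X -> \bar R) : measurable_fun setT F ->
  (forall x, 0 <= F x) -> \int[mu]_x F (aut_fun T x) = \int[mu]_x F x.
Proof.
move=> mF F0.
rewrite -[LHS](@ge0_integral_pushforward _ _ _ _ _ _ (measurable_aut T) mu setT F)//.
by apply: eq_measure_integral => A mA _; rewrite /= /pushforward mp_preserving.
Qed.

Lemma integral_dS_congr (f f' g g' : X -> X) :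
  measurable_fun setT f -> measurable_fun setT f' ->
  measurable_fun setT g -> measurable_fun setT g' ->
  (\forall x \ae mu, f x = f' x) -> (\forall x \ae mu, g x = g' x) ->
  \int[mu]_x dS (f x) (g x) = \int[mu]_x dS (f' x) (g' x).
Proof.
move=> mf mf' mg mg' ff' gg'; apply: ge0_ae_eq_integral => //.
- exact: measurable_dS.
- exact: measurable_dS.
- by move=> *; exact: dS_ge0.
- by move=> *; exact: dS_ge0.
- by apply: filterS2 ff' gg' => x -> ->.
Qed.

Local Notation d1 := (l1_dist a S).

Lemma l1_dist_ge0 T U : 0 <= d1 T U.
Proof. by apply: integral_ge0 => x _; exact: dS_ge0. Qed.

Lemma l1_distxx T : d1 T T = 0.
Proof. by rewrite /l1_dist integral0_eq// => x _; exact: dSxx. Qed.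

Lemma l1_dist_sym T U : d1 T U = d1 U T.
Proof. by apply: eq_integral => x _; exact: dS_sym. Qed.

Lemma l1_dist_triangle V T U : d1 T U <= d1 T V + d1 V U.
Proof.
rewrite -ge0_integralD//; first last.
- exact: measurable_dS.
- by move=> *; exact: dS_ge0.
- exact: measurable_dS.
- by move=> *; exact: dS_ge0.
apply: ge0_le_integral => //.
- by move=> *; exact: dS_ge0.
- exact: measurable_dS.
- by apply: emeasurable_funD; exact: measurable_dS.
- by move=> x _; exact: dS_triangle.
Qed.

Lemma l1_dist0_eq T U : d1 T U = 0 -> T = U.
Proof.
move=> d0; apply/aut_eqP.
have mdS : measurable_fun setT (fun x => dS (aut_fun T x) (aut_fun U x)).
  exact: measurable_dS.
have /(ae_eq_integral_abs mu measurableT mdS) :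
    \int[mu]_x `|dS (aut_fun T x) (aut_fun U x)| = 0.
  rewrite -[RHS]d0; apply: eq_integral => x _.
  by rewrite gee0_abs//; exact: dS_ge0.
apply: filterS => x /(_ I) /= e; apply: contrapT => /dS_ge1.
by rewrite e leNgt lte01.
Qed.

Lemma l1_distMr V T U : d1 (T * V)%g (U * V)%g = d1 T U.
Proof.
rewrite /l1_dist -[RHS](integral_aut V); last 2 first.
- exact: measurable_dS.
- by move=> x; exact: dS_ge0.
apply: integral_dS_congr => //.
- by apply: measurableT_comp.
- by apply: measurableT_comp.
- exact: aut_mulE.
- exact: aut_mulE.
Qed.

Lemma l1_dist1 T : d1 1%g T = \int[mu]_x dS x (aut_fun T x).
Proof.
apply: integral_dS_congr => //; first exact: aut_oneE.
exact: aeW.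
Qed.

Lemma full_group1 : full_group a 1%g.
Proof.
by apply: filterS (aut_oneE mu) => x ->; exists 1%g; rewrite pmp_act1.
Qed.

Lemma full_groupM T U : full_group a T -> full_group a U -> full_group a (T * U)%g.
Proof.
move=> /(mp_ae (repr U)) fT fU.
apply: filterS3 (aut_mulE T U) fT fU => x -> [g /= eg] [h eh].
by exists (g * h)%g; rewrite pmp_actM -eh -eg.
Qed.

Lemma full_groupV T : full_group a T -> full_group a T^-1%g.
Proof.
move=> /(mp_ae (mp_inverse (repr T))) fT.
apply: filterS2 (aut_invE T) fT => x -> [g /=].
rewrite /aut_fun mp_invK => xg; exists g^-1%g.
by rewrite [in RHS]xg -pmp_actM mulVg pmp_act1.
Qed.

Lemma l1_full_group_closed :
  group_closed (fun T : Aut mu => T \in l1_full_set a S).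
Proof.
split=> [|T U].
  rewrite unfold_in inE; split; first exact: full_group1.
  by rewrite -l1_dist1 l1_distxx ltry.
rewrite !unfold_in !inE => -[fT iT] [fU iU]; split.
  by apply: full_groupM => //; exact: full_groupV.
rewrite -l1_dist1 -(l1_distMr U) mul1g divgK.
apply: le_lt_trans (l1_dist_triangle 1%g U T) _.
by rewrite l1_dist_sym lte_add_pinfty// l1_dist1.
Qed.

End schreier_dist_theory.

Section l1_full_group.
Context (R : realType) d (X : standardBorelType R d) (mu : probability X R).
Context (Gamma : groupType) (a : pmp_action mu Gamma) (S : seq Gamma).

Record l1_full_group := L1FullGroup {
  l1_val :> Aut mu;
  l1_valP : l1_val \in l1_full_set a S
}.

HB.instance Definition _ := [isSub for l1_val].
HB.instance Definition _ := [Choice of l1_full_group by <:].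
HB.instance Definition _ := SubChoice_isSubGroup.Build _ _ l1_full_group
  (l1_full_group_closed a S).

Implicit Types T U V : l1_full_group.

Local Notation dS := (schreier_dist a S).
Local Notation d1 := (l1_dist a S).

Lemma l1_dist_fin T U : d1 T U \is a fin_num.
Proof.
rewrite ge0_fin_numE ?l1_dist_ge0//.
apply: le_lt_trans (l1_dist_triangle a S 1%g T U) _.
have := l1_valP T; have := l1_valP U; rewrite !inE => -[_ iU] [_ iT].
by rewrite (l1_dist_sym _ _ (l1_val T)) lte_add_pinfty// l1_dist1.
Qed.

Definition l1_mdist T U : R := fine (d1 T U).

Lemma l1_mdistE T U : (l1_mdist T U)%:E = d1 T U.
Proof. by rewrite fineK// l1_dist_fin. Qed.

Lemma l1_mdistxx T : l1_mdist T T = 0.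
Proof. by rewrite /l1_mdist l1_distxx. Qed.

Lemma l1_mdist0_eq T U : l1_mdist T U = 0 -> T = U.
Proof.
move=> e; apply/val_inj; apply: (@l1_dist0_eq _ _ _ _ _ a S).
by rewrite -l1_mdistE e.
Qed.

Lemma l1_mdist_sym T U : l1_mdist T U = l1_mdist U T.
Proof. by rewrite /l1_mdist l1_dist_sym. Qed.

Lemma l1_mdist_triangle V T U : l1_mdist T U <= l1_mdist T V + l1_mdist V U.
Proof. by rewrite -lee_fin EFinD !l1_mdistE; exact: l1_dist_triangle. Qed.

HB.instance Definition _ := @isMetric.Build R l1_full_group
  l1_mdist l1_mdistxx l1_mdist0_eq l1_mdist_sym l1_mdist_triangle.

Lemma l1_mdistMr V T U : l1_mdist (T * V)%g (U * V)%g = l1_mdist T U.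
Proof. by apply: EFin_inj; rewrite !l1_mdistE !valM l1_distMr. Qed.

Let psi T (n : nat) (x : X) : \bar R :=
  if (n%:R%:E < dS x (aut_fun T x))%E then dS x (aut_fun T x) else 0%E.

Let psi_ge0 T n x : (0 <= psi T n x)%E.
Proof. by rewrite /psi; case: ifPn => // _; exact: dS_ge0. Qed.

Let measurable_disp T : measurable_fun setT (fun x => dS x (aut_fun T x)).
Proof. by apply: measurable_dS => //; exact: measurable_aut. Qed.

Let measurable_psi T n : measurable_fun setT (psi T n).
Proof.
have mT := measurable_disp T.
apply: measurable_fun_ifT => //.
apply: measurable_fun_lte => //.
Qed.

Let psi_cvg T : (\int[mu]_x psi T n x @[n --> \oo] --> 0)%E.
Proof.
have /[!inE] -[_ iT] := l1_valP T.
have intT : mu.-integrable setT (fun x => dS x (aut_fun T x)).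
  apply/integrableP; split; first exact: measurable_disp.
  by under eq_integral do rewrite gee0_abs ?dS_ge0//.
have aeT := integrable_ae measurableT intT.
have [] := @dominated_convergence _ X R mu setT measurableT (psi T) (cst 0%E) _
  (measurable_psi T) (@measurable_cst _ _ _ _ _ _) _ intT.
- apply: filterS aeT => x /(_ I) fx _; apply: cvg_near_cst.
  have [e|[w [_ _ e]]] := dS_cases a S x (aut_fun T x); first by rewrite e in fx.
  near=> n; apply/eqP; rewrite /psi e ifF// lte_fin ltr_nat; apply/negbTE.
  by rewrite -leqNgt; near: n; exact: nbhs_infty_ge.
- apply: aeW => x n _; rewrite gee0_abs// /psi; case: ifPn => // _.
  exact: dS_ge0.
by move=> _ _; rewrite integral0.
Unshelve. all: by end_near. Qed.

Let psi_le T n u v : (dS (aut_fun T u) (aut_fun T v) <=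
  dS u v + (n%:R%:E * dS u v + psi T n u) + (n%:R%:E * dS u v + psi T n v))%E.
Proof.
have n0 : (0 <= n%:R%:E :> \bar R)%E by rewrite lee_fin.
have [<-|uv] := pselect (u = v).
  by rewrite dSxx !adde_ge0// ?mule_ge0 ?dS_ge0.
have dispE w : (dS w (aut_fun T w) <= n%:R%:E * dS u v + psi T n w)%E.
  rewrite /psi; case: ifPn => [_|]; first by rewrite leeDr// mule_ge0// dS_ge0.
  rewrite -leNgt adde0 => /le_trans; apply.
  by rewrite -[leLHS]mule1 lee_wpmul2l// dS_ge1.
apply: le_trans (dS_triangle a S u _ _) _.
rewrite dS_sym [in leRHS](addeC (dS u v)) -addeA leeD ?dispE//.
by apply: le_trans (dS_triangle a S v _ _) _; rewrite leeD2l ?dispE.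
Qed.

Let l1_mdistMl_le T U V n : (d1 (T * U)%g (T * V)%g <=
  d1 U V + (n%:R%:E * d1 U V + \int[mu]_x psi T n x)
         + (n%:R%:E * d1 U V + \int[mu]_x psi T n x))%E.
Proof.
have n0 : (0 <= n%:R%:E :> \bar R)%E by rewrite lee_fin.
have mUV : measurable_fun setT (fun x => dS (aut_fun U x) (aut_fun V x)).
  by apply: measurable_dS; exact: measurable_aut.
have mn : measurable_fun setT
    (fun x => n%:R%:E * dS (aut_fun U x) (aut_fun V x))%E.
  exact: emeasurable_funM.
have mpsi (W : Aut mu) : measurable_fun setT (fun x => psi T n (aut_fun W x)).
  by apply: measurableT_comp => //; exact: measurable_aut.
have -> : d1 (T * U)%g (T * V)%g = (\int[mu]_x
    dS (aut_fun T (aut_fun U x)) (aut_fun T (aut_fun V x)))%E.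
  apply: integral_dS_congr; try exact: measurable_aut; try exact: aut_mulE.
  - by apply: measurableT_comp; exact: measurable_aut.
  - by apply: measurableT_comp; exact: measurable_aut.
have dge0 x : (0 <= dS (aut_fun U x) (aut_fun V x))%E by exact: dS_ge0.
have nge0 x : (0 <= n%:R%:E * dS (aut_fun U x) (aut_fun V x))%E.
  exact: mule_ge0.
rewrite -{1}(integral_aut U (measurable_psi T n) (psi_ge0 T n)).
rewrite -(integral_aut V (measurable_psi T n) (psi_ge0 T n)).
rewrite -ge0_integralZl//.
have mnp (W : Aut mu) : measurable_fun setT (fun x =>
    n%:R%:E * dS (aut_fun U x) (aut_fun V x) + psi T n (aut_fun W x))%E.
  by apply: emeasurable_funD => //; exact: (mpsi W).
have np0 x y : (0 <= n%:R%:E * dS (aut_fun U x) (aut_fun V x) + psi T n y)%E.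
  by rewrite adde_ge0.
rewrite -!ge0_integralD//; first last.
- exact: emeasurable_funD.
- by move=> *; rewrite adde_ge0.
apply: ge0_le_integral => //.
- by move=> *; exact: dS_ge0.
- by apply: measurable_dS; apply: measurableT_comp; exact: measurable_aut.
- by apply: emeasurable_funD => //; exact: emeasurable_funD.
Qed.

Lemma l1_mdistMl_small T (e : R) : 0 < e -> exists2 r : R, 0 < r &
  forall U V, l1_mdist U V < r -> l1_mdist (T * U)%g (T * V)%g < e.
Proof.
move=> e0.
have e40 : 0 < e / 4 by rewrite divr_gt0.
have [n psin] : exists n, (\int[mu]_x psi T n x < (e / 4)%:E)%E.
  have nb : nbhs (0%E : \bar R) [set y | (y < (e / 4)%:E)%E].
    by apply: open_nbhs_nbhs; split; [exact: open_ereal_lt_ereal|rewrite /= lte_fin].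
  by have [N _ /(_ N (leqnn _))] := psi_cvg T nb; exists N.
have psif : (\int[mu]_x psi T n x)%E \is a fin_num.
  rewrite ge0_fin_numE; first exact: lt_trans psin (ltry _).
  by apply: integral_ge0 => x _; exact: psi_ge0.
have k0 : 0 < n%:R + n%:R + 1 :> R by rewrite ltr_wpDl// addr_ge0.
exists (e / 2 / (n%:R + n%:R + 1)); first by rewrite !divr_gt0.
move=> U V; rewrite ltr_pdivlMr// => UV.
have := l1_mdistMl_le T U V n.
move: psif psin; case: (\int[mu]_x psi T n x)%E => // p _.
rewrite lte_fin => pe.
rewrite -(l1_mdistE U V) -(l1_mdistE (T * U)%g (T * V)%g) -EFinM -!EFinD lee_fin.
move=> /le_lt_trans; apply; move: UV; set m := l1_mdist _ _ => UV.
suff : m * (n%:R + n%:R + 1) + p + p < e / 2 + e / 4 + e / 4 by lra.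
by rewrite !ltrD.
Qed.

Lemma l1_mulg_continuous :
  continuous (fun p : l1_full_group * l1_full_group => (p.1 * p.2)%g).
Proof.
move=> [T U]; apply/cvg_ballP => e e0.
have e20 : 0 < e / 2 by rewrite divr_gt0.
have [r r0 Tr] := l1_mdistMl_small T e20.
exists (ball T (e / 2), ball U r) => /=.
  by split; exact: nbhsx_ballx.
move=> [T' U'] /= [TT' UU'] /=.
rewrite (splitr e); apply: le_lt_trans (l1_mdist_triangle (T * U')%g _ _) _.
by rewrite ltrD//; [exact: Tr|rewrite l1_mdistMr].
Qed.

Lemma l1_invg_continuous : continuous (fun T : l1_full_group => (T^-1)%g).
Proof.
move=> T; apply/(@cvg_ballP _ _ _ _ (nbhs_filter T)) => e e0.
have [r r0 Tr] := l1_mdistMl_small T^-1%g e0.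
apply: (@filterS _ _ (nbhs_filter T) _ _ _ (nbhsx_ballx T r r0)) => U TU /=.
have -> : ball T^-1%g e U^-1%g = (l1_mdist T^-1%g U^-1%g < e) :> Prop by [].
rewrite -(l1_mdistMr U) mulVg -(mulVg T) l1_mdist_sym.
by apply: Tr.
Qed.

HB.instance Definition _ := isTopologicalGroup.Build l1_full_group
  l1_mulg_continuous l1_invg_continuous.

End l1_full_group.

(* Main.v *)
Require Import Defs.
From HB Require Import structures.
From mathcomp Require Import all_boot all_order all_algebra.
From mathcomp Require Import all_classical all_reals all_analysis.
From mathcomp Require Import measurable_realfun lra.

(** Why the theorem is true.  An invariant mean on Gamma is extracted from a
    fixed point of the L1 full group G on a compact convex set.  Take for that
    set the finitely additive probabilities [k] on the Borel subsets of
    [X * X] that give mass one to the orbit relation and have [mu] as first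
    marginal ([orbit_mean]); G acts by moving the first coordinate.  Two
    elements T and U of G move [k E] to values that differ by at most
    [mu {T <> U}], because the two translates of [E] agree above [{T = U}] and the
    first marginal of [k] is [mu].  This is at most the L1 distance of T and U, hence the action
    is jointly continuous on the pointwise compact set of all [k].  If a subset
    H is amenable, the barycenter [M] of an H-invariant measure on it is again
    an orbit mean, now fixed by H ([invariant_orbit_mean]).

    No element of H need act as g in Gamma does, but invariance can be
    checked piece by piece: if some T in H agrees with g on a set [A], then [M]
    is invariant under g above [A], and countably many such [A] suffice because
    the first marginal [mu] is countably additive ([translation_invariantT]).
    The derived subgroup of G has enough such T.  Whenever [A], [g A] and [h A]
    are disjoint, the commutator of the involutions exchanging [A] with [g A] and
    [A] with [h A] is a 3-cycle equal to g on [A] ([derived_translation]).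
    If g, h and 1 are distinct, freeness makes x, g x and h x distinct
    for almost every x, so countably many such [A] cover X
    ([derived_translation_cover]); such an h exists as soon as Gamma has three
    elements.

    Hence [M] is invariant under Gamma acting on the first coordinate, and
    sending a subset [A] of Gamma to the [M]-mass of the pairs (g y, y) with g
    in [A] is an invariant mean on Gamma ([amenable_orbit_mean]); freeness makes
    it additive.  The argument applies to every subset H containing the derived
    subgroup, in particular to G and to the closure of the derived subgroup. *)

Set Implicit Arguments.
Unset Strict Implicit.
Unset Printing Implicit Defensive.

Import Order.TTheory GRing.Theory Num.Theory.
Import numFieldNormedType.Exports.

Local Open Scope classical_set_scope.
Local Open Scope ring_scope.

(** * A fixed point property of amenable subsets *)

Section subtype_of_product.
Context (T : topologicalType) (A : set T).

Lemma set_val_cvg (Z : Type) (F : set_system Z) (f : Z -> set_type A) (k : set_type A) :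
  Filter F -> set_val (f z) @[z --> F] --> set_val k -> f z @[z --> F] --> k.
Proof.
move=> FF fk N [_ [[W oW <-] /= Wk WN]].
have : F [set z | W (set_val (f z))] by apply: (fk W); apply: open_nbhs_nbhs.
by apply: (@filterS _ F) => z /= Wz; exact: WN.
Qed.

Lemma compact_set_type : compact A -> compact [set: set_type A].
Proof.
move=> cA F PF FT.
have [|p [Ap clp]] := cA (set_val @ F) _.
  by apply: (@filterS _ F _ _ _ _ FT) => k _; exact: set_valP.
exists (exist _ p (mem_set Ap)); split => // V N FV [_ [[W oW <-] /= Wp WN]].
have [||q [[k Vk <-] Wk]] := clp (set_val @` V) W.
- by apply: (@filterS _ F _ _ _ _ FV) => k Vk /=; exists k.
- by apply: open_nbhs_nbhs.
by exists k; split => //; exact: WN.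
Qed.

Lemma hausdorff_set_type : hausdorff_space T -> hausdorff_space (set_type A).
Proof.
move=> hT p q clpq; apply/val_inj/hT => U V pU qV.
have /= [k [Uk Vk]] := clpq _ _ (initial_continuous pU) (initial_continuous qV).
by exists (set_val k).
Qed.

End subtype_of_product.

Lemma ptws_cvg (I Z : Type) (T : topologicalType) (F : set_system Z)
    (f : Z -> I -> T) (k : I -> T) : Filter F ->
  (forall i, f z i @[z --> F] --> k i) -> {ptws, f @ F --> k}.
Proof.
move=> FF fk; apply/cvg_sup => i N [_ [[W oW <-] /= Wk WN]].
have : F [set z | W (f z i)] by apply: (fk i W); apply: open_nbhs_nbhs.
by apply: (@filterS _ F) => z /= Wz; exact: WN.
Qed.

Lemma continuous_borel_measurable (R : realType) (K : ptopologicalType) (f : K -> R) :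
  continuous f ->
  measurable_fun [set: g_sigma_algebraType (@open K)] f.
Proof.
move=> /continuousP cf; apply: (measurability _ (RGenOpens.measurableE R)).
move=> _ [_ [a [b ->] <-]]; rewrite setTI; apply: sub_sigma_algebra.
exact/cf/interval_open.
Qed.

Lemma ptws_proj_continuous (I : Type) (T : topologicalType) (i : I) :
  continuous ((fun k : {ptws I -> T} => k i)).
Proof. exact: (@proj_continuous {classic I} (fun=> T) i). Qed.

Section invariant_barycenter.
Context (R : realType) (G : topologicalGroupType) (I : choiceType).
Variables (P : set {ptws I -> R}) (t : G -> I -> I) (k0 : I -> R).

Hypothesis P0 : P k0.
Hypothesis P_closed : closed P.
Hypothesis P_bounded : forall k i, P k -> 0 <= k i <= 1.
Hypothesis t_stable : forall g k, P k -> P (k \o t g).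
Hypothesis t1 : forall k i, P k -> k (t 1%g i) = k i.
Hypothesis tM : forall g h k i, P k -> k (t (g * h)%g i) = k (t h (t g i)).
Hypothesis t_equicontinuous : forall g i (e : R), 0 < e ->
  \forall h \near g, forall k, P k -> `|k (t g i) - k (t h i)| < e.

(** The group acts on the indices by [t], hence affinely on the compact set [P]
    by precomposition.  Equicontinuity of the orbit maps, uniformly over [P], is
    what makes this action jointly continuous, so that amenability applies.  The
    conclusion keeps the invariant measure and the evaluation functions instead
    of the barycenter itself: whether the barycenter belongs to [P] is better
    seen from the constraints defining [P]. *)
Lemma exists_invariant_barycenter (H : set G) : amenable R H ->
  exists d (W : measurableType d) (m : probability W R) (k : W -> I -> R),
  [/\ forall w, P (k w),
      forall i, measurable_fun setT (k ^~ i) &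
      forall g i, H g -> (\int[m]_w (k w (t g i))%:E = \int[m]_w (k w i)%:E)%E].
Proof.
move=> amH.
pose PK := isPointed.Build (set_type P) (exist _ k0 (mem_set P0)).
pose K : ptopologicalType := HB.pack (set_type P) PK.
pose ev (k : K) : I -> R := set_val k.
have evP k : P (ev k) by exact: set_valP.
have ev_cont i : continuous (fun k : K => ev k i).
  move=> k; apply: (@continuous_comp K {ptws I -> R} R set_val (fun k => k i)).
    exact: initial_continuous.
  exact: ptws_proj_continuous.
pose act (g : G) (k : K) : K := exist _ (ev k \o t g) (mem_set (t_stable g (evP k))).
have evact g k i : ev (act g k) i = ev k (t g i) by [].
have evI k l : (forall i, ev k i = ev l i) -> k = l.
  by move=> kl; apply/val_inj/funext.
have Kcompact : compact [set: K].
  apply: compact_set_type.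
  apply: (@subclosed_compact _ _ [set k : {ptws I -> R} | forall i, [set` `[0, 1]] (k i)]).
  - exact: P_closed.
  - exact: (@tychonoff I (fun=> R) (fun=> [set` `[0, 1]]) (fun=> @segment_compact R 0 1)).
  - by move=> k Pk i /=; rewrite in_itv /= P_bounded.
have Khausdorff : hausdorff_space K.
  by apply: hausdorff_set_type; exact: (@hausdorff_product I (fun=> R) (fun=> @Rhausdorff R)).
have act_cont : continuous (fun p : G * K => act p.1 p.2).
  move=> [g k]; apply: set_val_cvg; apply: ptws_cvg => i.
  apply/cvgrPdist_lt => e e0.
  have e2 : 0 < e / 2 by rewrite divr_gt0.
  have /cvgrPdist_lt/(_ _ e2) nk := ev_cont (t g i) k.
  exists ([set h | forall k, P k -> `|k (t g i) - k (t h i)| < e / 2],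
     [set l | `|ev k (t g i) - ev l (t g i)| < e / 2]).
    by split; [exact: t_equicontinuous|exact: nk].
  move=> [h l] /= [/(_ _ (evP l)) hl kl].
  rewrite (splitr e) -(subrKA (ev l (t g i))).
  by rewrite (le_lt_trans (ler_normD _ _))// ltrD.
have [|m minv] := amH K act Kcompact Khausdorff.
  split.
  - by move=> k; apply: evI => i; rewrite evact t1.
  - by move=> g h k _ _; apply: evI => i; rewrite !evact tM.
  - exact: continuous_subspaceT.
have ev_meas i := continuous_borel_measurable (ev_cont i).
exists _, (g_sigma_algebraType (@open K)), m, ev; split => // g i Hg.
have act_meas : measurable_fun [set: g_sigma_algebraType (@open K)]
    (act g : g_sigma_algebraType (@open K) -> g_sigma_algebraType (@open K)).
  apply: (@measurability _ _ (g_sigma_algebraType (@open K))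
    (g_sigma_algebraType (@open K)) _ _ (@open K)) => // _ [U oU <-].
  rewrite setTI.
  apply: sub_sigma_algebra; suff /continuousP : continuous (act g : K -> K) by exact.
  move=> k; have FK : Filter (nbhs k) := nbhs_filter k.
  by apply: set_val_cvg; apply: ptws_cvg => j; exact: ev_cont.
under eq_integral do rewrite -evact.
rewrite -[LHS](@ge0_integral_pushforward _ _ _ _ _ _ act_meas m setT
  (fun k => (ev k i)%:E))//.
- by apply: eq_measure_integral => A mA _; rewrite /= /pushforward minv.
- exact/measurable_EFinP.
- by move=> k _; rewrite lee_fin; have /andP[] := P_bounded i (evP k).
Qed.

End invariant_barycenter.

(** * Finite generation and standard Borel spaces *)

Section finitely_generated.
Context (Gamma : groupType) (S : seq Gamma).
Hypothesis S_generates : subgroup_generated [set` S] = [set: Gamma].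
Local Open Scope group_scope.

Lemma generated_word (g : Gamma) : exists2 w : seq Gamma,
  all (letter S) w & g = foldr (fun s h => s * h) 1 w.
Proof.
pose H := [set g | exists2 w : seq Gamma, all (letter S) w & g = foldr (fun s h => s * h) 1 w].
have catE (w w' : seq Gamma) : foldr (fun s h => s * h) 1 (w ++ w') =
    foldr (fun s h => s * h) 1 w * foldr (fun s h => s * h) 1 w'.
  by elim: w => [|s w IH] /=; rewrite ?mul1g// IH mulgA.
suff HT : [set: Gamma] `<=` H by exact: HT.
rewrite -S_generates; apply: smallest_sub; last first.
  by move=> s /= sS; exists [:: s]; rewrite /= ?mulg1// /letter sS.
split=> [|_ _ [u Su ->] [v Sv ->]]; first by exists [::].
exists (u ++ rev [seq s^-1 | s <- v]).
  rewrite all_cat Su all_rev all_map; apply: sub_all Sv => s.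
  exact: letterV.
rewrite catE; congr (_ * _); elim: v Sv => [|s v IH] /=; first by rewrite invg1.
move=> /andP[_ /IH e]; rewrite invgM rev_cons -cats1 catE -e /= mulg1.
by [].
Qed.

Lemma generated_countable : countable [set: Gamma].
Proof.
pose L := S ++ [seq s^-1 | s <- S].
pose f (s : seq nat) : Gamma := foldr (fun s h => s * h) 1 [seq nth 1 L i | i <- s].
apply: (@sub_countable _ _ _ (f @` [set: seq nat])); last first.
  exact: (@sub_countable _ _ _ [set: seq nat] (card_image_le _ _)).
apply: subset_card_le => g _; have [w Sw ->] := generated_word g.
exists [seq index s L | s <- w] => //; rewrite /f -map_comp; congr foldr.
rewrite -[RHS]map_id; apply/eq_in_map => s ws /=; rewrite nth_index//.
have := allP Sw _ ws; rewrite /letter mem_cat => /orP[->//|sS].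
by apply/orP; right; apply/mapP; exists s^-1 => //; rewrite invgK.
Qed.

Lemma schreier_dist_translation (R : realType) d (X : measurableType d)
    (mu : probability X R) (a : pmp_action mu Gamma) (g : Gamma) :
  exists n : nat, forall x, (schreier_dist a S x (a g x) <= n%:R%:E)%E.
Proof.
have [w Sw ->] := generated_word g; exists (size w) => x.
suff -> : a (foldr (fun s h => s * h) 1 w) x = foldr a x w.
  by apply: ereal_inf_lbound; exists w.
by elim: w {Sw} => [|s w IH] /=; rewrite ?pmp_act1// pmp_actM IH.
Qed.

End finitely_generated.

(** The ordered form, with [x] inside and [y] outside, is obtained from a countable
    base because a Hausdorff space is T1; it spares a case distinction each time
    points are separated. *)
Lemma standard_borel_separating (R : realType) d (X : standardBorelType R d) :
  exists B : nat -> set X, (forall n, measurable (B n)) /\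
    forall x y, x <> y -> exists n, B n x /\ ~ B n y.
Proof.
have [P [h [hP [B cB [Bo Bb]] bh mE]]] := @standard_borel_subproof R d X.
have mh U : B U -> measurable (h @^-1` U).
  move=> BU; rewrite mE; exists U; last by rewrite setTI.
  by apply: sub_sigma_algebra; exact: Bo.
have sepB x y : x <> y -> exists U, [/\ B U, U (h x) & ~ U (h y)].
  move=> /eqP xy.
  have hxy : h x != h y by apply: contra_neq xy; exact: bij_inj.
  have [U [oU]] := hausdorff_accessible hP hxy; rewrite !inE => Ux Uy.
  have [V [BV Vx] VU] := Bb (h x) U (open_nbhs_nbhs (conj oU Ux)).
  by exists V; split => // Vy; exact/Uy/VU.
move/pfcard_geP : cB => [B0|[e]].
  exists (fun=> set0); split => // x y /sepB[U [BU]].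
  by rewrite B0 in BU.
exists (fun n => h @^-1` (e n)); split => [n|x y /sepB[U [BU Ux Uy]]].
  by apply: mh; exact: funS.
have [n _ en] : range e U by rewrite image_eq.
by exists n; rewrite /= en.
Qed.

(** * Means on the orbit relation *)

Section orbit_means.
Context (R : realType) d (X : standardBorelType R d) (mu : probability X R).
Context (Gamma : groupType) (a : pmp_action mu Gamma).

Definition orbit_pairs (A : set Gamma) : set (X * X) :=
  [set p | exists2 g, A g & p.1 = a g p.2].

(** Means are defined on all subsets of [X * X], with value zero off the
    measurable ones, so that they live in a plain power of the real line and the
    action by preimages is defined without side conditions.  The second marginal
    is left free: it carries the information about Gamma. *)
Record orbit_mean (k : set (X * X) -> R) : Prop := OrbitMean {
  orbit_mean_bounded : forall E, 0 <= k E <= 1;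
  orbit_mean_nonmeasurable : forall E, ~ measurable E -> k E = 0;
  orbit_meanU : forall E F, measurable E -> measurable F ->
    E `&` F = set0 -> k (E `|` F) = k E + k F;
  orbit_mean_fst : forall B, measurable B -> k (fst @^-1` B) = fine (mu B);
  orbit_mean_orbit : k (orbit_pairs setT) = 1
}.

Lemma measurable_orbit_pairs A : countable [set: Gamma] -> measurable (orbit_pairs A).
Proof.
move=> Gamma_countable.
have [B [mB sepB]] := standard_borel_separating X.
have -> : orbit_pairs A = \bigcup_g (if g \in A then [set p | p.1 = a g p.2] else set0).
  apply/seteqP; split=> [p [g Ag pg]|p [g _]].
    by exists g => //; rewrite mem_set.
  by case: ifPn => // /set_mem Ag pg; exists g.
apply: countable_bigcupT_measurable => // g; case: ifPn => // _.
have -> : [set p : X * X | p.1 = a g p.2] =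
    ~` \bigcup_n (fst @^-1` B n `&` snd @^-1` (a g @^-1` ~` B n)).
  apply/seteqP; split=> [p /= pg [n _ []] /=|p np /=]; first by rewrite pg.
  by apply: contrapT => /sepB[n [Bp Bg]]; apply: np; exists n.
apply: measurableC; apply: bigcupT_measurable => n; apply: measurableI.
  by rewrite -[_ @^-1` _]setTI; apply: measurable_fst.
rewrite -[_ @^-1` _]setTI; apply: measurable_snd => //.
rewrite -[_ @^-1` _]setTI; apply: pmp_measurable => //.
exact: measurableC.
Qed.

Lemma measurable_preimage_fst (B : set X) :
  measurable B -> measurable (fst @^-1` B : set (X * X)).
Proof. by move=> mB; rewrite -[_ @^-1` _]setTI; exact: measurable_fst. Qed.

Section theory.
Variables (k : set (X * X) -> R) (km : orbit_mean k).

Let k_ge0 E : 0 <= k E.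
Proof. by have /andP[] := orbit_mean_bounded km E. Qed.

Lemma orbit_mean_split (D E : set (X * X)) : measurable D -> measurable E ->
  k E = k (E `&` D) + k (E `&` ~` D).
Proof.
move=> mD mE; rewrite -(orbit_meanU km).
- by rewrite -setIUr setUv setIT.
- exact: measurableI.
- by apply: measurableI => //; exact: measurableC.
- by rewrite setIACA setICr setI0.
Qed.

Lemma le_orbit_mean (E F : set (X * X)) :
  measurable E -> measurable F -> E `<=` F -> k E <= k F.
Proof.
move=> mE mF EF; rewrite (orbit_mean_split mE mF) setIidr// lerDl.
exact: k_ge0.
Qed.

(** Only the part above [D] can distinguish [E] from [F], and its mass is
    controlled by the first marginal. *)
Lemma orbit_mean_dist (D : set X) (E F : set (X * X)) :
  measurable D -> measurable E -> measurable F ->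
  (forall p, ~ D p.1 -> E p <-> F p) -> `|k E - k F| <= fine (mu D).
Proof.
move=> mD mE mF EF; have mD1 := measurable_preimage_fst mD.
rewrite (orbit_mean_split mD1 mE) (orbit_mean_split mD1 mF).
have -> : E `&` ~` (fst @^-1` D) = F `&` ~` (fst @^-1` D).
  by apply/seteqP; split=> p /= [Ep nDp]; split => //; apply/EF.
have kD G : measurable G -> 0 <= k (G `&` fst @^-1` D) <= fine (mu D).
  move=> mG; rewrite k_ge0 -(orbit_mean_fst km mD) le_orbit_mean//.
  exact: measurableI.
have := kD _ mE; have := kD _ mF; rewrite ler_norml.
by move=> /andP[F0 F1] /andP[E0 E1]; apply/andP; split; lra.
Qed.

(** Finitely additive as it is, an orbit mean does not charge the sets lying above
    a null set, so that elements of the full group, which are defined up to null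
    sets, act on orbit means. *)
Lemma orbit_mean_ae_eq (Q : X -> Prop) (E F : set (X * X)) :
  (\forall x \ae mu, Q x) -> measurable E -> measurable F ->
  (forall p, Q p.1 -> E p <-> F p) -> k E = k F.
Proof.
move=> [N [mN N0 QN]] mE mF EF; apply/eqP; rewrite -subr_eq0 -normr_le0.
have <- : fine (mu N) = 0 by rewrite N0.
apply: orbit_mean_dist => // p nNp; apply: EF; apply: contrapT => nQ.
exact/nNp/QN.
Qed.

End theory.

Definition transport (T : Aut mu) (E : set (X * X)) : set (X * X) :=
  [set p | E (aut_fun T p.1, p.2)].

Lemma measurable_transport T E : measurable E -> measurable (transport T E).
Proof.
move=> mE; have mf : measurable_fun [set: X * X] (fun p => (aut_fun T p.1, p.2)).
  apply: measurable_fun_pair; last exact: measurable_snd.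
  by apply: measurableT_comp; [exact: measurable_aut|exact: measurable_fst].
by rewrite -[transport _ _]setTI; exact: mf.
Qed.

(** With its converse, this ensures that transporting preserves the convention that
    means vanish on non-measurable sets. *)
Lemma transport_measurable T E : measurable (transport T E) -> measurable E.
Proof.
move=> mE; have mf : measurable_fun [set: X * X] (fun p => (mp_inv (repr T) p.1, p.2)).
  apply: measurable_fun_pair; last exact: measurable_snd.
  by apply: measurableT_comp; [exact: mp_inv_measurable|exact: measurable_fst].
have -> : E = (fun p => (mp_inv (repr T) p.1, p.2)) @^-1` transport T E.
  by apply/seteqP; split=> -[x y]; rewrite /transport /aut_fun /= mp_invK.
by rewrite -[_ @^-1` _]setTI; exact: mf.
Qed.

Lemma orbit_mean_transport T k : countable [set: Gamma] ->
  full_group a T -> orbit_mean k -> orbit_mean (k \o transport T).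
Proof.
move=> cG fT km; split => /=.
- by move=> E; exact: orbit_mean_bounded.
- move=> E nE; apply: (orbit_mean_nonmeasurable km).
  by move=> /transport_measurable.
- move=> E F mE mF EF; rewrite -(orbit_meanU km); first by [].
  + exact: measurable_transport.
  + exact: measurable_transport.
  + apply/seteqP; split=> // p [Ep Fp].
    by have : (E `&` F) (aut_fun T p.1, p.2) by []; rewrite EF.
- move=> B mB; transitivity (k (fst @^-1` (aut_fun T @^-1` B))); first by [].
  rewrite (orbit_mean_fst km) ?mp_preserving//.
  exact: mp_preimageE.
- rewrite -[RHS](orbit_mean_orbit km).
  apply: (orbit_mean_ae_eq km fT).
  + by apply: measurable_transport; exact: measurable_orbit_pairs.
  + exact: measurable_orbit_pairs.
  + move=> [x y] /= [g gx]; rewrite /transport /orbit_pairs /= gx; split=> -[h _ hy].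
      by exists (g^-1 * h)%g => //; rewrite pmp_actM -hy -pmp_actM mulVg pmp_act1.
    by exists (g * h)%g => //; rewrite pmp_actM -hy.
Qed.

(** The image of [mu] under the diagonal map: the simplest point of the compact
    set of orbit means. *)
Definition diagonal_mean (E : set (X * X)) : R :=
  if `[< measurable E >] then fine (mu [set x | E (x, x)]) else 0.

Lemma diagonal_orbit_mean : countable [set: Gamma] -> orbit_mean diagonal_mean.
Proof.
move=> cG.
have mdiag (E : set (X * X)) : measurable E -> measurable [set x | E (x, x)].
  move=> mE; have mf : measurable_fun [set: X] (fun x => (x, x)).
    by apply: measurable_fun_pair; exact: measurable_id.
  by rewrite -[X in measurable X]setTI; exact: mf.
have dE E : measurable E -> diagonal_mean E = fine (mu [set x | E (x, x)]).
  by move=> mE; rewrite /diagonal_mean; case: asboolP.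
split.
- move=> E; rewrite /diagonal_mean; case: asboolP => mE; last by rewrite lexx ler01.
  rewrite fine_ge0//= -lee_fin fineK ?fin_num_measure//; last exact: mdiag.
  by apply: probability_le1; exact: mdiag.
- by move=> E nE; rewrite /diagonal_mean; case: asboolP.
- move=> E F mE mF EF; rewrite !dE//; last exact: measurableU.
  rewrite -fineD ?fin_num_measure//; try exact: mdiag.
  rewrite -measureU//; try exact: mdiag.
  by apply/seteqP; split=> // x [Ex Fx]; have : (E `&` F) (x, x) by []; rewrite EF.
- move=> B mB; rewrite dE//; exact: measurable_preimage_fst.
- rewrite dE; last exact: measurable_orbit_pairs.
  rewrite (_ : [set _ | _] = setT) ?probability_setT//.
  by apply/seteqP; split=> // x _; exists 1%g => //; rewrite pmp_act1.
Qed.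

Lemma closed_orbit_mean : closed (orbit_mean : set {ptws set (X * X) -> R}).
Proof.
pose T := {ptws set (X * X) -> R}.
have ev E : continuous (fun k : T => k E) by exact: ptws_proj_continuous.
have pre (f : T -> R) D : continuous f -> closed D -> closed (f @^-1` D).
  by move=> /continuous_closedP; exact.
have eq_closed E (c : R) : closed [set k : T | k E = c].
  apply: (pre (fun k => k E) [set x | x = c]); [exact: ev|exact: closed_eq].
pose C1 := [set k : T | forall E, 0 <= k E <= 1].
pose C2 := [set k : T | forall E, ~ measurable E -> k E = 0].
pose C3 := [set k : T | forall E F, measurable E -> measurable F ->
  E `&` F = set0 -> k (E `|` F) = k E + k F].
pose C4 := [set k : T | forall B, measurable B -> k (fst @^-1` B) = fine (mu B)].
pose C5 := [set k : T | k (orbit_pairs setT) = 1].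
have -> : (orbit_mean : set T) = C1 `&` C2 `&` C3 `&` C4 `&` C5.
  by apply/seteqP; split=> k [] => [|[[[]]]] *; do !split.
repeat apply: closedI.
- have -> : C1 = \bigcap_E [set k : T | 0 <= k E] `&` \bigcap_E [set k : T | k E <= 1].
    apply/seteqP; split=> [k kC|k [k0 k1] E]; last by rewrite k0 // k1.
    by split=> E _; have /andP[] := kC E.
  apply: closedI; apply: closed_bigI => E _.
    by apply: (pre (fun k => k E) [set x | 0 <= x]); [exact: ev|exact: closed_ge].
  by apply: (pre (fun k => k E) [set x | x <= 1]); [exact: ev|exact: closed_le].
- have -> : C2 = \bigcap_(E in ~` measurable) [set k : T | k E = 0] by [].
  by apply: closed_bigI => E _.
- have -> : C3 = \bigcap_(EF in [set EF : set (X * X) * set (X * X) |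
      [/\ measurable EF.1, measurable EF.2 & EF.1 `&` EF.2 = set0]])
      [set k : T | k (EF.1 `|` EF.2) - (k EF.1 + k EF.2) = 0].
    apply/seteqP; split=> [k kC [E F] /= [mE mF EF]|k kC E F mE mF EF].
      by rewrite kC// subrr.
    by apply/eqP; rewrite -subr_eq0; apply/eqP/(kC (E, F)).
  apply: closed_bigI => -[E F] _ /=.
  apply: (pre (fun k => k (E `|` F) - (k E + k F)) [set 0]); last exact: closed_eq.
  by move=> k; exact: (cvgB (ev (E `|` F) k) (cvgD (ev E k) (ev F k))).
- have -> : C4 = \bigcap_(B in measurable) [set k : T | k (fst @^-1` B) = fine (mu B)].
    by [].
  by apply: closed_bigI => B _.
- exact: eq_closed.
Qed.

Lemma barycenter_orbit_mean d' (W : measurableType d') (m : probability W R)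
    (k : W -> set (X * X) -> R) :
  (forall w, orbit_mean (k w)) -> (forall E, measurable_fun setT (k ^~ E)) ->
  orbit_mean (fun E => fine (\int[m]_w (k w E)%:E)).
Proof.
move=> km mk.
have int01 E : (0 <= \int[m]_w (k w E)%:E <= 1)%E.
  apply/andP; split.
    by apply: integral_ge0 => w _; rewrite lee_fin; have /andP[] := orbit_mean_bounded (km w) E.
  rewrite -[leRHS](@probability_setT _ _ _ m) -[leRHS]mul1e -integral_cst//.
  apply: ge0_le_integral => //.
  - by move=> w _; rewrite lee_fin; have /andP[] := orbit_mean_bounded (km w) E.
  - exact/measurable_EFinP.
  - by move=> w _; rewrite lee_fin; have /andP[] := orbit_mean_bounded (km w) E.
have int_fin E : (\int[m]_w (k w E)%:E)%E \is a fin_num.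
  have /andP[i0 i1] := int01 E; rewrite ge0_fin_numE//.
  by rewrite (le_lt_trans i1)// ltry.
have int_cst E c : (forall w, k w E = c) -> fine (\int[m]_w (k w E)%:E)%E = c.
  move=> kc; under eq_integral do rewrite kc.
  by rewrite integral_cst// [X in (_ * X)%E]probability_setT mule1.
split.
- by move=> E; rewrite -!lee_fin fineK.
- by move=> E nE; apply: int_cst => w; exact: orbit_mean_nonmeasurable.
- move=> E F mE mF EF; rewrite -fineD// -ge0_integralD//.
  + by congr fine; apply: eq_integral => w _; rewrite (orbit_meanU (km w)).
  + by move=> w _; rewrite lee_fin; have /andP[] := orbit_mean_bounded (km w) E.
  + exact/measurable_EFinP.
  + by move=> w _; rewrite lee_fin; have /andP[] := orbit_mean_bounded (km w) F.
  + exact/measurable_EFinP.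
- by move=> B mB; apply: int_cst => w; exact: orbit_mean_fst.
- by apply: int_cst => w; exact: orbit_mean_orbit.
Qed.

End orbit_means.

(** * Partial translations in the derived subgroup *)

Section representatives.
Context (R : realType) d (X : measurableType d) (mu : probability X R).

Definition represents (T : Aut mu) (f : mp_bijection mu) : Prop :=
  \forall x \ae mu, aut_fun T x = f x.

Lemma represents_mul T U f g :
  represents T f -> represents U g -> represents (T * U)%g (mp_comp f g).
Proof.
move=> Tf Ug; have Tfg := mp_ae g Tf.
by apply: filterS3 (aut_mulE T U) Ug Tfg => x -> -> ->.
Qed.

Lemma represents_inv T f : represents T f -> represents T^-1%g (mp_inverse f).
Proof.
move=> /(mp_ae (mp_inverse f)) Tf.
apply: filterS2 (aut_invE T) Tf => x -> /=; rewrite mp_invK => e.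
by rewrite -[in LHS]e /aut_fun mp_funK.
Qed.

End representatives.

Section translations.
Context (R : realType) d (X : measurableType d) (mu : probability X R).
Context (Gamma : groupType) (a : pmp_action mu Gamma).

Lemma act_gK g : cancel (a g) (a g^-1%g).
Proof. by move=> x; rewrite -pmp_actM mulVg pmp_act1. Qed.

Lemma act_gVK g : cancel (a g^-1%g) (a g).
Proof. by move=> x; rewrite -pmp_actM mulgV pmp_act1. Qed.

Lemma measurable_act_preimage g A : measurable A -> measurable (a g @^-1` A).
Proof. by move=> mA; rewrite -[_ @^-1` _]setTI; exact: pmp_measurable. Qed.

Definition act_mp (g : Gamma) : mp_bijection mu :=
  MPBijection (act_gK g) (act_gVK g) (pmp_measurable a g)
    (pmp_measurable a g^-1%g) (pmp_preserving a g).

Section swap.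
Variables (g : Gamma) (A : set X).
Hypothesis A_measurable : measurable A.
Hypothesis A_disjoint : forall x, A x -> ~ A (a g x).

Let A' := a g^-1%g @^-1` A.

Let mA' : measurable A'.
Proof. exact: measurable_act_preimage. Qed.

Let AA' x : A x -> ~ A' x.
Proof. by move=> Ax /A_disjoint; rewrite act_gVK. Qed.

Definition swap (x : X) : X :=
  if x \in A then a g x else if a g^-1%g x \in A then a g^-1%g x else x.

Lemma swap_in x : A x -> swap x = a g x.
Proof. by move=> Ax; rewrite /swap mem_set. Qed.

Lemma swap_image x : A (a g^-1%g x) -> swap x = a g^-1%g x.
Proof. by move=> A'x; rewrite /swap memNset ?mem_set// => /AA'. Qed.

Lemma swap_out x : ~ A x -> ~ A (a g^-1%g x) -> swap x = x.
Proof. by move=> nAx nA'x; rewrite /swap !memNset. Qed.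

Lemma swapK : involutive swap.
Proof.
move=> x; have [Ax|nAx] := pselect (A x).
  by rewrite (swap_in Ax) swap_image act_gK.
have [A'x|nA'x] := pselect (A' x).
  by rewrite (swap_image A'x) swap_in// act_gVK.
by rewrite !swap_out.
Qed.

Let swap_preimage_in B : swap @^-1` B `&` A = a g @^-1` (B `&` A').
Proof.
apply/seteqP; split=> x /= [].
  by move=> + Ax; rewrite swap_in// /A' /= act_gK.
by rewrite /A' /= act_gK => Bx Ax; rewrite swap_in.
Qed.

Let swap_preimage_image B :
  (swap @^-1` B `&` ~` A) `&` A' = a g^-1%g @^-1` (B `&` A).
Proof.
apply/seteqP; split=> x /= [].
  by move=> [+ _] A'x; rewrite swap_image.
by move=> Bx A'x; rewrite swap_image//; split=> //; split=> // /AA'.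
Qed.

Let swap_preimage_out B :
  (swap @^-1` B `&` ~` A) `&` ~` A' = (B `&` ~` A) `&` ~` A'.
Proof.
by apply/seteqP; split=> x /= [[Bx Ax] A'x]; split=> //; split=> //; move: Bx;
  rewrite swap_out.
Qed.

Let setI_split (E D : set X) : E = (E `&` D) `|` (E `&` ~` D).
Proof. by rewrite -setIUr setUv setIT. Qed.

Lemma measurable_swap : measurable_fun setT swap.
Proof.
move=> _ B mB; rewrite setTI (setI_split (swap @^-1` B) A).
rewrite (setI_split (_ `&` ~` A) A').
rewrite swap_preimage_in swap_preimage_image swap_preimage_out.
apply: measurableU; first exact/measurable_act_preimage/measurableI.
apply: measurableU; first exact/measurable_act_preimage/measurableI.
by apply: measurableI; [apply: measurableI => //|]; exact: measurableC.
Qed.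

(** The preimage of [B] splits along [A], [g A] and the rest; the action carries
    the first two pieces onto [B] inside [g A] and [B] inside [A]. *)
Lemma swap_preserving B : measurable B -> mu (swap @^-1` B) = mu B.
Proof.
move=> mB.
have split2 E D : measurable E -> measurable D ->
    mu E = (mu (E `&` D) + mu (E `&` ~` D))%E.
  move=> mE mD; rewrite -measureU.
  - by rewrite -setI_split.
  - exact: measurableI.
  - by apply: measurableI => //; exact: measurableC.
  - by rewrite setIACA setICr setI0.
have msB : measurable (swap @^-1` B).
  by rewrite -[_ @^-1` _]setTI; exact: measurable_swap.
have split3 E : measurable E -> mu E =
    (mu (E `&` A) + (mu (E `&` ~` A `&` A') + mu (E `&` ~` A `&` ~` A')))%E.
  move=> mE; rewrite (split2 E A)// (split2 (_ `&` ~` A) A')//.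
  by apply: measurableI => //; exact: measurableC.
rewrite (split3 _ msB) (split3 _ mB).
rewrite swap_preimage_in swap_preimage_image swap_preimage_out.
rewrite !pmp_preserving; [|exact: measurableI..].
have -> : B `&` ~` A `&` A' = B `&` A'.
  by apply/seteqP; split=> x; [move=> [[]]|move=> [Bx A'x]; split=> //; split=> // /AA'].
by rewrite !addeA (addeC (mu (B `&` A'))).
Qed.

Definition swap_mp : mp_bijection mu :=
  MPBijection swapK swapK measurable_swap measurable_swap swap_preserving.

End swap.
End translations.

Section l1_full_group_elements.
Context (R : realType) d (X : standardBorelType R d) (mu : probability X R).
Context (Gamma : groupType) (S : seq Gamma) (a : pmp_action mu Gamma).
Hypothesis S_generates : subgroup_generated [set` S] = [set: Gamma].

(** The displacement of a swap is bounded by the word lengths of g and of its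
    inverse, hence integrable. *)
Lemma l1_swap g A (mA : measurable A) (dA : forall x, A x -> ~ A (a g x)) :
  exists T : l1_full_group a S, represents (l1_val T) (swap_mp mA dA).
Proof.
pose s := swap_mp mA dA.
have rs : represents (\pi_(Aut mu) s)%qT s by exact: aut_fun_pi.
suff Ts : (\pi_(Aut mu) s)%qT \in l1_full_set a S by exists (L1FullGroup Ts).
rewrite inE; split.
  apply: filterS rs => x -> /=; rewrite /swap.
  case: ifPn => _; first by exists g.
  by case: ifPn => _; [exists g^-1%g|exists 1%g; rewrite pmp_act1].
have [n gn] := schreier_dist_translation S_generates a g.
have [n' gn'] := schreier_dist_translation S_generates a g^-1%g.
rewrite (@integral_dS_congr _ _ _ _ _ a S id id (aut_fun (\pi_(Aut mu) s)%qT) s)//; first last.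
- exact: aeW.
- exact: mp_measurable.
- exact: measurable_aut.
apply: (@le_lt_trans _ _ (\int[mu]_x (n + n')%:R%:E)%E).
  apply: ge0_le_integral => //.
  - by move=> *; exact: dS_ge0.
  - by apply: measurable_dS => //; exact: mp_measurable.
  - move=> x _ /=; rewrite /swap; case: ifPn => _.
      by apply: (le_trans (gn x)); rewrite lee_fin ler_nat leq_addr.
    case: ifPn => _; last by rewrite dSxx lee_fin.
    by apply: (le_trans (gn' x)); rewrite lee_fin ler_nat leq_addl.
by rewrite integral_cst// [X in (_ * X)%E]probability_setT mule1 ltry.
Qed.

(** With [s] swapping [A] and [g A], and [t] swapping [A] and [h A], a point x of [A]
    goes to h x under [t], stays there under [s], comes back to x under the inverse
    of [t], and goes to g x under the inverse of [s]. *)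
Lemma derived_translation g h A : measurable A ->
  (forall x, A x -> ~ A (a g x)) -> (forall x, A x -> ~ A (a h x)) ->
  (forall x y, A x -> A y -> a g x <> a h y) ->
  exists2 T : l1_full_group a S, derived_subgroup (l1_full_group a S) T &
    \forall x \ae mu, A x -> aut_fun (l1_val T) x = a g x.
Proof.
move=> mA gA hA ghA.
have [s rs] := l1_swap mA gA; have [t rt] := l1_swap mA hA.
exists [~ s, t]%g.
  apply: sub_gen_smallest; exists s => //; exists t => //.
have rc := represents_mul (represents_inv rs)
  (represents_mul (represents_inv rt) (represents_mul rs rt)).
apply: filterS rc => x + Ax; rewrite /= => ->.
rewrite [swap a h A x]swap_in// [swap a g A (a h x)]swap_out.
- by rewrite [swap a h A _]swap_image ?act_gK// swap_in.
- exact: (hA _ Ax).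
- by move=> Ay; apply: (ghA _ _ Ay Ax); rewrite act_gVK.
Qed.

End l1_full_group_elements.

(** * Invariance of a mean under the group action *)

Section translation_invariance.
Context (R : realType) d (X : standardBorelType R d) (mu : probability X R).
Context (Gamma : groupType) (a : pmp_action mu Gamma).
Variables (M : set (X * X) -> R) (Mm : orbit_mean a M).

Definition translate (g : Gamma) (E : set (X * X)) : set (X * X) :=
  [set p | E (a g p.1, p.2)].

Lemma measurable_translate g E : measurable E -> measurable (translate g E).
Proof.
move=> mE; have mf : measurable_fun [set: X * X] (fun p => (a g p.1, p.2)).
  apply: measurable_fun_pair; last exact: measurable_snd.
  by apply: measurableT_comp; [exact: pmp_measurable|exact: measurable_fst].
by rewrite -[translate _ _]setTI; exact: mf.
Qed.

Definition translation_invariant_on (g : Gamma) (C : set X) : Prop :=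
  forall E, measurable E ->
    M (translate g E `&` fst @^-1` C) = M (E `&` fst @^-1` (a g^-1%g @^-1` C)).

(** [T] is injective and agrees with g on [C], so that [C] is, up to a null set,
    the whole preimage of [g C] under [T]: transporting the part of [E] above
    [g C] by [T] amounts to translating it by g. *)
Lemma invariant_on_transport (T : Aut mu) g C : measurable C ->
  (forall E, measurable E -> M (transport T E) = M E) ->
  (\forall x \ae mu, C x -> aut_fun T x = a g x) ->
  translation_invariant_on g C.
Proof.
move=> mC MT TC E mE.
have mgC : measurable (a g^-1%g @^-1` C) by exact: measurable_act_preimage.
have mEC : measurable (E `&` fst @^-1` (a g^-1%g @^-1` C)).
  by apply: measurableI => //; exact: measurable_preimage_fst.
rewrite -[RHS]MT//.
have TC' := mp_ae (mp_comp (act_mp a g^-1%g) (repr T)) TC.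
have TCC : \forall x \ae mu, (C x -> aut_fun T x = a g x) /\
    (C (a g^-1%g (aut_fun T x)) -> C x).
  apply: filterS2 TC TC' => x Tx /= Tx'; split=> // Cx.
  have /(can_inj (mp_funK _)) <- // : aut_fun T (a g^-1%g (aut_fun T x)) = aut_fun T x.
  by rewrite Tx' ?act_gVK.
apply: (orbit_mean_ae_eq Mm TCC).
- by apply: measurableI; [exact: measurable_translate|exact: measurable_preimage_fst].
- exact: measurable_transport.
- move=> [x y] /= [Tx Cx]; rewrite /translate /transport /=; split=> -[Ep Cp].
    by rewrite Tx// act_gK.
  by have /Tx <- := Cx Cp; split => //; exact: Cx.
Qed.

Lemma invariant_on_sub g C D : measurable D -> D `<=` C ->
  translation_invariant_on g C -> translation_invariant_on g D.
Proof.
move=> mD DC MC E mE.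
have := MC (E `&` fst @^-1` (a g^-1%g @^-1` D)).
rewrite -setIA -preimage_setI -preimage_setI (setIidl DC) => <-; last first.
  apply: measurableI => //; apply: measurable_preimage_fst.
  exact: measurable_act_preimage.
congr M; apply/seteqP; split=> [[x y] /= [Ep Dx]|[x y] /= [[Ep]]].
  by rewrite /translate /= act_gK; do !split=> //; exact: DC.
by rewrite /= act_gK.
Qed.

Lemma invariant_onU g C D : measurable C -> measurable D ->
  translation_invariant_on g C -> translation_invariant_on g D ->
  translation_invariant_on g (C `|` D).
Proof.
move=> mC mD MC MD E mE.
have mDC : measurable (D `\` C) by exact: measurableD.
have MDC := invariant_on_sub mDC (@subDsetl _ _ _) MD.
have add (F : set (X * X)) (A B : set X) : measurable F -> measurable A -> measurable B ->
    A `&` B = set0 ->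
    M (F `&` fst @^-1` (A `|` B)) = M (F `&` fst @^-1` A) + M (F `&` fst @^-1` B).
  move=> mF mA mB AB; rewrite preimage_setU setIUr (orbit_meanU Mm)//.
  - by apply: measurableI => //; exact: measurable_preimage_fst.
  - by apply: measurableI => //; exact: measurable_preimage_fst.
  - by rewrite setIACA -[X in _ `&` X]preimage_setI AB preimage_set0 setI0.
have -> : C `|` D = C `|` D `\` C.
  apply/seteqP; split=> x; last by case=> [|[]]; [left|right].
  by have [|nCx] := pselect (C x); [left|case=> // Dx; right].
rewrite preimage_setU !add ?MC ?MDC//.
- exact: measurable_act_preimage.
- exact: measurable_act_preimage.
- by rewrite -preimage_setI setDIK preimage_set0.
- exact: measurable_translate.
- by rewrite setDIK.
Qed.

(** [M] is only finitely additive, but the error made by restricting to finitely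
    many of the [A n] is at most the [mu]-mass of what they leave uncovered,
    which tends to zero. *)
Lemma translation_invariantT g (A : nat -> set X) :
  (forall n, measurable (A n)) ->
  (forall n, translation_invariant_on g (A n)) ->
  (\forall x \ae mu, exists n, A n x) ->
  forall E, measurable E -> M (translate g E) = M E.
Proof.
move=> mA MA covA E mE.
pose F n := \big[setU/set0]_(i < n) A i.
have mF n : measurable (F n) by apply: bigsetU_measurable => i _; exact: mA.
have MF n : translation_invariant_on g (F n).
  elim: n => [|n IH]; last first.
    by rewrite /F big_ord_recr; apply: invariant_onU (mF n) (mA n) IH (MA n).
  by move=> E' _; rewrite /F big_ord0 !preimage_set0 !setI0.
have mUA : measurable (\bigcup_n A n) by exact: bigcupT_measurable.
have muA : mu (\bigcup_n A n) = 1%E.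
  have : mu (~` \bigcup_n A n) = 0%E.
    apply/negligibleP; first exact: measurableC.
    by apply: negligibleS covA => x nAx [n Anx]; apply: nAx; exists n.
  by move=> U0; rewrite -[X in mu X]setCK probability_setC ?U0 ?sube0//; exact: measurableC.
have Fcvg : mu (F n) @[n --> \oo] --> 1%E.
  have FU : \bigcup_n F n = \bigcup_n A n.
    apply/seteqP; split=> x [n _]; first by rewrite /F -bigcup_mkord => -[m _]; exists m.
    by move=> Anx; exists n.+1 => //; rewrite /F big_ord_recr; right.
  rewrite -muA -FU; apply: (@nondecreasing_cvg_mu _ _ _ mu F) => //; first by rewrite FU.
  by move=> m n mn; apply/subsetPset; exact: subset_bigsetU.
have bound n : `|M (translate g E) - M E| <= 1 - fine (mu (F n)).
  have mF1 : measurable (fst @^-1` F n : set (X * X)) by exact: measurable_preimage_fst.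
  have mG : measurable (a g^-1%g @^-1` F n) by exact: measurable_act_preimage.
  have mG1 := measurable_preimage_fst mG.
  rewrite (orbit_mean_split Mm mF1 (measurable_translate g mE)) (orbit_mean_split Mm mG1 mE).
  rewrite MF//.
  have small (B : set X) E' : measurable B -> measurable E' ->
      0 <= M (E' `&` ~` (fst @^-1` B)) <= 1 - fine (mu B).
    move=> mB mE'; have mB' : measurable (~` B) by exact: measurableC.
    have /andP[-> _] /= := orbit_mean_bounded Mm (E' `&` ~` (fst @^-1` B)).
    have -> : 1 - fine (mu B) = fine (mu (~` B)).
      by rewrite probability_setC// fineB ?fin_num_measure.
    rewrite -(orbit_mean_fst Mm mB'); apply: (le_orbit_mean Mm).
    - by apply: measurableI => //; apply: measurableC; exact: measurable_preimage_fst.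
    - exact: measurable_preimage_fst.
    - by move=> p [].
  have := small _ _ (mF n) (measurable_translate g mE).
  have := small _ _ mG mE; rewrite pmp_preserving//.
  move=> /andP[l1 u1] /andP[l2 u2]; rewrite ler_norml; apply/andP; split; lra.
apply/eqP; rewrite -subr_eq0 -normr_le0 -(subrr 1).
have Fcvg' : 1 - fine (mu (F n)) @[n --> \oo] --> (1 - 1 : R).
  by apply: cvgB; [exact: cvg_cst|exact: fine_cvg].
rewrite -(cvg_lim _ Fcvg')//; apply: limr_ge; first by apply/cvg_ex; exists (1 - 1).
by apply: nearW => n; exact: bound.
Qed.

End translation_invariance.

(** * The non-amenability theorem *)

(** A group without three distinct elements has no room for the 3-cycles used
    below, but it is finite and its normalized counting measure is invariant. *)
Lemma amenable_discrete_order2 (R : realType) (Gamma : groupType) (g : Gamma) :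
  (forall h, h = 1%g \/ h = g) -> amenable_discrete R Gamma.
Proof.
move=> G2.
have gg : (g * g = 1)%g.
  have [//|/(congr1 (fun h => g^-1 * h)%g)] := G2 (g * g)%g.
  by rewrite mulgA mulVg mul1g => ->; rewrite mulg1.
have memE (A : set Gamma) h k : (g * h = k)%g ->
    (k \in [set (g * x)%g | x in A]) = (h \in A).
  move=> <-; apply/idP/idP; rewrite !inE; first by move=> [x Ax /mulgI <-].
  by move=> Ah; exists h.
exists (fun A => ((1%g \in A)%:R + (g \in A)%:R) / 2); split.
- by move=> A; rewrite divr_ge0// addr_ge0.
- by rewrite !mem_set//= -[1 + 1]/(2 : R) divff// pnatr_eq0.
- move=> A B AB; rewrite !in_setU -mulrDl; congr (_ / 2).
  have orD x : ((x \in A) || (x \in B))%:R = (x \in A)%:R + (x \in B)%:R :> R.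
    have [xA|_] := boolP (x \in A); last by rewrite add0r.
    have [xB|_] := boolP (x \in B); last by rewrite addr0.
    by have : (A `&` B) x by [split; exact: set_mem]; rewrite AB.
  by rewrite !orD addrACA.
- move=> h A; have [->|->] := G2 h.
    by under eq_imagel do rewrite mul1g; rewrite image_id.
  rewrite (memE A g 1%g)// (memE A 1%g g) ?mulg1//.
  by rewrite addrC.
Qed.

Section core.
Context (R : realType) d (X : standardBorelType R d) (mu : probability X R).
Context (Gamma : groupType) (S : seq Gamma) (a : pmp_action mu Gamma).
Hypothesis S_generates : subgroup_generated [set` S] = [set: Gamma].
Hypothesis a_free : free_action a.

Let G := l1_full_group a S.
Let cG : countable [set: Gamma] := generated_countable S_generates.

Lemma l1_full_groupP (T : G) : full_group a (l1_val T).
Proof. by have := l1_valP T; rewrite inE => -[]. Qed.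

(** Distinct points are at Schreier distance at least one. *)
Lemma mu_neq_le_l1_dist (T U : G) :
  fine (mu [set x | aut_fun (l1_val T) x <> aut_fun (l1_val U) x]) <= l1_mdist T U.
Proof.
set D := [set x | _].
have mD : measurable D.
  by apply: measurableC; apply: measurable_eq_fun; exact: measurable_aut.
rewrite -lee_fin l1_mdistE fineK ?fin_num_measure//.
rewrite -[D]setIT -integral_indic//; apply: ge0_le_integral => //.
- by apply/measurable_EFinP; exact: measurable_indic.
- by apply: measurable_dS; exact: measurable_aut.
- move=> x _; rewrite indicE; have [/set_mem Dx|_] := boolP (x \in D).
    exact: dS_ge1.
  exact: dS_ge0.
Qed.

(** The fixed point property for the action on orbit means, in which the bounds
    [mu_neq_le_l1_dist] and [orbit_mean_dist] give the equicontinuity. *)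
Lemma invariant_orbit_mean (H : set G) : amenable R H ->
  exists2 M : set (X * X) -> R, orbit_mean a M &
    forall T E, H T -> M (transport (l1_val T) E) = M E.
Proof.
move=> amH.
have [|||||||d' [W [m [k [km mk kH]]]]] :=
  @exists_invariant_barycenter R G (set (X * X)) (orbit_mean a)
    (fun T E => transport (l1_val T) E) (diagonal_mean mu) _ _ _ _ _ _ _ H amH.
- exact: diagonal_orbit_mean.
- exact: closed_orbit_mean.
- by move=> k E km; exact: (orbit_mean_bounded km).
- by move=> T k km; apply: orbit_mean_transport => //; exact: l1_full_groupP.
- move=> k E km; have [mE|nE] := pselect (measurable E); last first.
    rewrite !(orbit_mean_nonmeasurable km)//.
    by move=> /transport_measurable.
  apply: (orbit_mean_ae_eq km (aut_oneE mu)) => //; first exact: measurable_transport.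
  by move=> [x y] /= e; rewrite /transport /= e.
- move=> T U k E km; have [mE|nE] := pselect (measurable E); last first.
    rewrite !(orbit_mean_nonmeasurable km)// => /transport_measurable//.
    by move=> /transport_measurable.
  apply: (orbit_mean_ae_eq km (aut_mulE (l1_val T) (l1_val U))).
  + exact: measurable_transport.
  + by apply: measurable_transport; exact: measurable_transport.
  + by move=> [x y] /= e; rewrite /transport /= e.
- move=> T E e e0.
  apply: (@filterS _ _ (nbhs_filter T) _ _ _ (nbhsx_ballx T e e0)) => U TU k km.
  have [mE|nE] := pselect (measurable E); last first.
    rewrite !(orbit_mean_nonmeasurable km) ?subrr ?normr0//.
      by move=> /transport_measurable.
    by move=> /transport_measurable.
  apply: le_lt_trans TU; apply: le_trans (mu_neq_le_l1_dist T U).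
  apply: (orbit_mean_dist km).
  + by apply: measurableC; apply: measurable_eq_fun; exact: measurable_aut.
  + exact: measurable_transport.
  + exact: measurable_transport.
  + by move=> [x y] /= /contrapT e1; rewrite /transport /= e1.
exists (fun E => fine (\int[m]_w (k w E)%:E)).
  exact: barycenter_orbit_mean.
by move=> T E HT /=; rewrite kH.
Qed.

(** For x, g x and h x distinct, three members of a countable separating family
    tell them apart pairwise; the points told apart by a given triple form one of
    the sets of the cover. *)
Lemma derived_translation_cover g h : g <> 1%g -> h <> 1%g -> g <> h ->
  exists A : nat -> set X, [/\ forall n, measurable (A n),
    forall n, exists2 T : G, derived_subgroup G T &
      \forall x \ae mu, A n x -> aut_fun (l1_val T) x = a g x &
    \forall x \ae mu, exists n, A n x].
Proof.
move=> g1 h1 gh; have [B [mB sepB]] := standard_borel_separating X.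
(* The identity is written [a 1] so that all three separations are between
   translations by elements of Gamma. *)
pose sep (f f' : X -> X) i := f @^-1` B i `&` f' @^-1` ~` B i.
pose C (i j l : nat) : set X :=
  sep (a 1%g) (a g) i `&` sep (a 1%g) (a h) j `&` sep (a g) (a h) l.
pose A n : set X := if unpickle n is Some (i, j, l) then C i j l else set0.
have msep (f f' : Gamma) i : measurable (sep (a f) (a f') i).
  by apply: measurableI; apply: measurable_act_preimage => //; exact: measurableC.
have mC i j l : measurable (C i j l).
  by apply: measurableI => //; exact: measurableI.
have mA n : measurable (A n).
  by rewrite /A; case: unpickle => [[[i j] l]|].
exists A; split=> // [n|].
  apply: derived_translation => //.
  - by rewrite /A; case: unpickle => [[[i j] l]|//] x [[[_ /= nBg] _] _] [[[+ _] _] _];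
      rewrite /= pmp_act1 => /nBg.
  - by rewrite /A; case: unpickle => [[[i j] l]|//] x [[_ [_ /= nBg]] _] [[_ [+ _]] _];
      rewrite /= pmp_act1 => /nBg.
  - by rewrite /A; case: unpickle => [[[i j] l]|//] x y [_ [Bg _]] [_ [_ nBh]] /= e;
      apply: nBh; rewrite /= -e.
apply: filterS a_free => x freex.
have ne f f' : f <> f' -> a f x <> a f' x.
  move=> ff' e; apply: ff'; have := freex (f'^-1 * f)%g.
  rewrite pmp_actM e act_gK => /(_ erefl)/(congr1 (fun k => f' * k)%g).
  by rewrite mulVKg mulg1.
have [i Bi] := sepB _ _ (ne _ _ (nesym g1)).
have [j Bj] := sepB _ _ (ne _ _ (nesym h1)).
have [l Bl] := sepB _ _ (ne _ _ gh).
by exists (pickle (i, j, l)); rewrite /A pickleK.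
Qed.

(** The pairs (g y, y) with g in [A] are carried onto those with g in [h A] by h acting
    on the first coordinate.  Freeness gives almost every pair of the orbit
    relation a single g, whence additivity. *)
Lemma amenable_orbit_mean (M : set (X * X) -> R) : orbit_mean a M ->
  (forall g E, measurable E -> M (translate a g E) = M E) -> amenable_discrete R Gamma.
Proof.
move=> Mm Minv.
have mO A : measurable (orbit_pairs a A) by exact: measurable_orbit_pairs.
exists (fun A => M (orbit_pairs a A)); split.
- by move=> A; have /andP[] := orbit_mean_bounded Mm (orbit_pairs a A).
- exact: orbit_mean_orbit.
- move=> A B AB.
  have -> : orbit_pairs a (A `|` B) =
      orbit_pairs a A `|` (orbit_pairs a B `\` orbit_pairs a A).
    apply/seteqP; split=> [p [g [Ag|Bg] pg]|p [[g Ag pg]|[[g Bg pg] _]]].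
    + by left; exists g.
    + have [|nA] := pselect (orbit_pairs a A p); first by left.
      by right; split => //; exists g.
    + by exists g => //; left.
    + by exists g => //; right.
  rewrite (orbit_meanU Mm)//; last 2 first.
  + exact: measurableD.
  + by rewrite setDIK.
  congr (_ + _); apply: (orbit_mean_ae_eq Mm a_free) => //; first exact: measurableD.
  move=> [x y] /= freex; split=> [[]//|Oy]; split => // -[g Ag /= xg].
  have [h Bh /= xh] := Oy.
  have hg : (h * g^-1)%g = 1%g by apply: freex; rewrite pmp_actM {1}xg act_gK -xh.
  have : (A `&` B) g by split => //; rewrite -[g]mul1g -hg mulgVK.
  by rewrite AB.
- move=> g A; rewrite -(Minv g)//; congr M; apply/seteqP; split=> -[x y] /=.
    move=> [_ [h Ah <-]] /= /(congr1 (a g^-1%g)); rewrite pmp_actM !act_gK => xh.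
    by exists h.
  by move=> [h Ah /= ->]; exists (g * h)%g; [exists h|rewrite /= pmp_actM].
Qed.

(** The form common to the whole group and to the closure of its derived
    subgroup. *)
Lemma amenable_derived (H : set G) : derived_subgroup G `<=` H -> amenable R H ->
  amenable_discrete R Gamma.
Proof.
move=> DH amH.
have [//|nam] := pselect (amenable_discrete R Gamma).
have [M Mm MH] := invariant_orbit_mean amH.
apply: (amenable_orbit_mean Mm) => g E mE.
have [->|g1] := pselect (g = 1%g).
  by congr M; apply/seteqP; split=> -[x y]; rewrite /translate /= pmp_act1.
have [h [h1 gh]] : exists h, h <> 1%g /\ g <> h.
  apply: contrapT => nh; apply: nam; apply: (@amenable_discrete_order2 R Gamma g) => h.
  apply: contrapT => /not_orP[h1 hg]; apply: nh; exists h; split => //.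
  exact: nesym.
have [A [mA TA covA]] := derived_translation_cover g1 h1 gh.
apply: (translation_invariantT Mm mA _ covA) => // n.
have [T DT TgA] := TA n.
apply: (invariant_on_transport Mm (mA n) _ TgA) => F _.
by apply: MH; exact: DH.
Qed.

End core.

Theorem theorem1p9 (R : realType) (d : measure_display)
    (X : standardBorelType R d) (mu : probability X R)
    (Gamma : groupType) (S : seq Gamma) (a : pmp_action mu Gamma)
    (mu_nonatomic : nonatomic mu)
    (S_generates : subgroup_generated [set` S] = [set: Gamma])
    (Gamma_nonamenable : ~ amenable_discrete R Gamma)
    (a_free : free_action a) :
  ~ amenable R [set: l1_full_group a S] /\
  ~ amenable R (closure (derived_subgroup (l1_full_group a S))).
Proof.
split=> am; apply: Gamma_nonamenable.
  by apply: (amenable_derived S_generates a_free _ am).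
by apply: (amenable_derived S_generates a_free _ am); exact: subset_closure.
Qed.
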